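(* Let $X$ be a topological space and let $A$ be a subset of $X$. Then $$|\mathrm{cl}_\theta(A)|\le |A|^{\kappa(X)}\cdot nu(X)\qquad\text{and}\qquad |[A]_\theta|\le (|A|\cdot nu(X))^{\kappa(X)}.$$
   Context: No separation axioms are assumed. $\overline{U}$ denotes the closure of $U$ in $X$, and $\mathcal{N}_x$ denotes the family of all open neighborhoods of $x$ in $X$. The $\theta$-closure of $A\subset X$ is $\mathrm{cl}_\theta(A)=\{x\in X: \overline{U}\cap A\ne\emptyset \text{ for every } U\in\mathcal{N}_x\}$. A set $A$ is $\theta$-closed if $A=\mathrm{cl}_\theta(A)$. The $\theta$-closed hull $[A]_\theta$ is the smallest $\theta$-closed set containing $A$, i.e. the intersection of all $\theta$-closed subsets of $X$ containing $A$. $\kappa(X)$ is the smallest infinite cardinal $\kappa$ such that for each $x\in X$ there is a collection $\mathcal{V}_x$ of closed neighborhoods of $x$ (closed sets containing $x$ in their interior) with $|\mathcal{V}_x|\le\kappa$ such that for every $W\in\mathcal{N}_x$ the set $\overline{W}$ contains a member of $\mathcal{V}_x$. A nonempty set $M\subset X$ is finitely non-Urysohn if for every nonempty finite $F\subset M$ and every choice of open neighborhoods $U_x\in\mathcal{N}_x$ ($x\in F$), $\bigcap_{x\in F}\overline{U_x}\ne\emptyset$. The non-Urysohn number of $X$ is the cardinal $nu(X)=1+\sup\{|M|: M \text{ is a finitely non-Urysohn subset of } X\}$; it may be finite. *)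

(* Defs.v *)
From mathcomp Require Import all_boot.
From mathcomp Require Import boolp classical_sets functions cardinality.
From mathcomp Require Import filter topology.
Set Implicit Arguments.
Unset Strict Implicit.
Unset Printing Implicit Defensive.
Local Open Scope classical_set_scope.
Local Open Scope card_scope.

(* A cardinal is represented by a type having that many elements: products,
   powers and [1 + k] are [A * B], [K -> A] and [option K], and cardinals are
   compared with [#<=]. *)

Definition is_least_card (P : Type -> Prop) (K : Type) : Prop :=
  P K /\ forall L : Type, P L -> [set: K] #<= [set: L].

Lemma set_inj_card_le (T U : Type) (A : set T) (f : T -> U) :
  set_inj A f -> A #<= [set: U].
Proof. by move=> /Pinj[g _]; exact/inj_card_le/[injfun of 'totalfun_A g]. Qed.

(* A maximal set of points of the product of the family on which every
   projection is injective must cover some factor, which then embeds into all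
   the others. *)
Lemma ex_least_family (S : Type) (K : S -> Type) (s0 : S) :
  exists s, forall t, [set: K s] #<= [set: K t].
Proof.
pose T := forall s : S, K s.
pose inj_on (M : set T) :=
  forall f g : T, M f -> M g -> forall s, f s = g s -> f = g.
have [M [Minj Mmax]] : exists M, inj_on M /\ forall B, M `<` B -> ~ inj_on B.
  apply: Zorn_bigcup => F FP totF f g [A FA Af] [B FB Bg] s fgs.
  have [AB|BA] := totF A B FA FB.
    by apply: (FP B FB) fgs => //; exact: AB.
  by apply: (FP A FA) fgs => //; exact: BA.
have [[s sS]|/forallNP nS] :=
    pselect (exists s : S, forall k : K s, exists f, M f /\ f s = k).
  exists s => t; have [c cP] := choice sS.
  apply: (@set_inj_card_le _ _ _ (fun k => c k t)) => k1 k2 _ _ E.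
  have [Mk1 <-] := cP k1; have [Mk2 <-] := cP k2.
  by rewrite (Minj _ _ Mk1 Mk2 t E).
have {}nS : forall s : S, exists k : K s, forall f, M f -> f s <> k.
  move=> s; have /existsNP[k /forallNP kP] := nS s.
  by exists k => f Mf fk; apply: (kP f).
pose h : T := fun s => sval (cid (nS s)).
have hP s f : M f -> f s <> h s by exact: (svalP (cid (nS s))).
exfalso; apply: (Mmax (M `|` [set h])).
  split; first by move=> f Mf; left.
  by move=> /(_ h (or_intror erefl)) /(hP s0).
move=> f g [Mf|->] [Mg|->] s //.
- exact: Minj.
- by move=> /(hP s f Mf).
- by move=> /esym /(hP s g Mg).
Qed.

Lemma card_le_total (K L : Type) :
  [set: K] #<= [set: L] \/ [set: L] #<= [set: K].
Proof.
have [[] h] := @ex_least_family bool (fun b => if b then K else L) true.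
  by left; exact: (h false).
by right; exact: (h true).
Qed.

(* Up to equipotence the candidates below [K0] form a family indexed by subsets
   of [K0]; this keeps the universe of the index at that of [K0]. *)
Lemma ex_least_card (P : Type -> Prop) :
  (exists K, P K) -> exists K, is_least_card P K.
Proof.
move=> [K0 PK0].
pose Q (B : K0 -> Prop) (L : Type) := P L /\ [set: L] #= B.
pose S := {B : K0 -> Prop | exists L, Q B L}.
have S0 : S.
  by exists setT; exists K0; split => //; exact: card_eqxx.
pose K (s : S) := sval (cid (svalP s)).
have KP (s : S) : Q (sval s) (K s) := svalP (cid (svalP s)).
have [s sP] := ex_least_family K S0.
exists (K s); split=> [|L PL]; first exact: (KP s).1.
have leK0 (L' : Type) : P L' -> [set: L'] #<= [set: K0] ->
    [set: K s] #<= [set: L'].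
  move=> PL' /card_leP[f].
  pose g (x : L') : K0 := set_val (f (to_setT x)).
  have g_inj : injective g.
    by move=> x y /val_inj /(inj (in_setT _) (in_setT _)) [].
  pose B : set K0 := range g.
  have L'B : [set: L'] #= B.
    by rewrite card_eq_sym; apply: inj_card_eq => x y _ _; exact: g_inj.
  have QB : exists L, Q B L by exists L'.
  pose t : S := exist _ B QB.
  apply: card_le_trans (sP t) _.
  by rewrite (card_le_eql (KP t).2) (card_le_eqr L'B) card_lexx.
have [LK0|K0L] := card_le_total L K0; first exact: leK0.
by apply: card_le_trans K0L; exact: leK0 (card_lexx _).
Qed.

Definition is_card_ub (T : Type) (F : set (set T)) (K : Type) : Prop :=
  forall M, F M -> M #<= [set: K].

Lemma ex_card_ub (T : Type) (F : set (set T)) : exists K, is_card_ub F K.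
Proof. by exists T => M _; exact: card_leT. Qed.

Definition card_sup (T : Type) (F : set (set T)) : Type :=
  sval (cid (ex_least_card (ex_card_ub F))).

Lemma card_supP (T : Type) (F : set (set T)) :
  is_least_card (is_card_ub F) (card_sup F).
Proof. exact: (svalP (cid (ex_least_card (ex_card_ub F)))). Qed.

Section Invariants.
Variable X : topologicalType.
Implicit Types (A M F U V C W : set X).

Definition cl_theta A : set X :=
  [set x | forall U, open_nbhs x U -> closure U `&` A !=set0].

Definition theta_closed A : Prop := A = cl_theta A.

Definition theta_hull A : set X := smallest theta_closed A.

Definition kappa_bound (K : Type) : Prop :=
  infinite_set [set: K] /\
  forall x : X, exists V : set (set X),
    [/\ V #<= [set: K],
        forall C, V C -> closed C /\ interior C x
      & forall W, open_nbhs x W -> exists2 C, V C & C `<=` closure W].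

Lemma ex_kappa_bound : exists K, kappa_bound K.
Proof.
exists ((X -> Prop) + nat)%type; split.
  by apply/infiniteP/(@set_inj_card_le _ _ _ inr) => m n _ _ [].
move=> x; exists [set C | closed C /\ interior C x]; split=> //.
  by apply: (@set_inj_card_le _ _ _ inl) => C D _ _ [].
move=> W [oW Wx]; exists (closure W) => //; split; first exact: closed_closure.
apply: filterS (open_nbhs_nbhs (conj oW Wx)); exact: subset_closure.
Qed.

Definition kappa : Type := sval (cid (ex_least_card ex_kappa_bound)).

Lemma kappaP : is_least_card kappa_bound kappa.
Proof. exact: (svalP (cid (ex_least_card ex_kappa_bound))). Qed.

Definition finitely_non_urysohn M : Prop :=
  M !=set0 /\
  forall F, finite_set F -> F !=set0 -> F `<=` M ->
  forall U : X -> set X, (forall x, F x -> open_nbhs x (U x)) ->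
    \bigcap_(x in F) closure (U x) !=set0.

Definition nu : Type := option (card_sup finitely_non_urysohn).

End Invariants.

(* Main.v *)
Require Import Defs.
From mathcomp Require Import all_boot.
From mathcomp Require Import boolp classical_sets functions cardinality.
From mathcomp Require Import filter topology.
Local Open Scope classical_set_scope.
Local Open Scope card_scope.

(** Write [K] for the cardinal kappa and [S] for the supremum of the sizes of
    the finitely non-Urysohn sets.

    Enumerate by [K] a base of closed neighbourhoods [v x k] at each point [x].
    If [x] lies in [cl_theta B], every finite intersection of the [v x k] meets
    [B], so some [a : seq K -> B] satisfies [a s \in v x k] for all [k] in [s];
    say that [a] traces [x].  The points traced by one and the same [a] form a
    finitely non-Urysohn set: given finitely many of them and closed
    neighbourhoods [v x (k x)], the single point [a (map k s)], where [s] lists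
    these points, lies in all of them.  So at most [S] points are traced by
    a given [a], and since [K] is infinite, [a] may be indexed by [K] rather
    than by [seq K].  This gives an operation [e : (K -> X) -> S -> X] that does not
    depend on [B] and such that every point of [cl_theta B] is [e b m] for some
    [b] with values in [B] ([cl_theta_cover]).  The first bound is immediate.

    For the second, the least set that contains [A] and is closed under [e] is
    theta-closed, so it contains the hull, and its points are values of
    well-founded [K]-branching trees whose leaves are marked by [A] and whose
    nodes are marked by [S].  Such a tree is determined by the labels it shows
    along the finite paths, hence by a function [seq K -> A * option S]
    ([label_inj]), and [option S] is the non-Urysohn number.

    Both halves need [seq K] to embed in [K] for infinite [K]
    ([seq_retract_infinite]); this is Hessenberg's theorem in a form for which
    Zorn's lemma applies directly to lists. *)

(** * Injections and enumerations *)

(** A default point of the target makes the underlying function total. *)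
Lemma card_le_inj {T U : Type} {A : set T} {B : set U} (b : U) :
  A #<= B -> exists f : T -> U, set_fun A B f /\ set_inj A f.
Proof.
elim/Ppointed: U => U in B b *; first by case: (no b).
by move=> /pcard_leP[f]; exists f; split; [exact: funS | exact: inj].
Qed.

Lemma set_inj_retract {T U : Type} {A : set T} {f : T -> U} {a : T} :
  A a -> set_inj A f ->
  exists g : U -> T, (forall u, A (g u)) /\ forall x, A x -> g (f x) = x.
Proof.
move=> Aa f_inj.
have /choice[g gP] : forall u, exists x,
    A x /\ forall y, A y -> f y = u -> y = x.
  move=> u; have [[x [Ax <-]]|nu] := pselect (exists x, A x /\ f x = u).
    by exists x; split=> // y Ay; apply: f_inj; rewrite inE.
  by exists a; split=> // y Ay fy; case: nu; exists y.
exists g; split=> [u|x Ax]; first by have [] := gP u.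
by have [_ /(_ x Ax erefl)] := gP (f x).
Qed.

Lemma card_le_enum {T K : Type} {A : set T} :
  A #<= [set: K] -> A !=set0 ->
  exists f : K -> T, (forall k, A (f k)) /\ forall x, A x -> exists k, f k = x.
Proof.
move=> AK [a Aa]; have /card_leP[i] := AK.
have [f [_ f_inj]] := card_le_inj (set_val (i (SigSub (mem_set Aa)))) AK.
have [g [gA gf]] := set_inj_retract Aa f_inj.
by exists g; split=> // x Ax; exists (f x); exact: gf.
Qed.

Lemma card_le_of_cover {T U : Type} {A : set T} (f : U -> T) :
  (forall x, A x -> exists u, f u = x) -> A #<= [set: U].
Proof.
move=> fA; apply: card_le_trans (card_image_le f setT).
by apply: subset_card_le => x /fA[u <-]; exists u.
Qed.

(** * Lists over an infinite set *)

Definition lists {K : Type} (B : set K) : set (seq K) :=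
  [set s | all (fun x => x \in B) s].

Lemma lists_cons {K : Type} (B : set K) x s :
  lists B (x :: s) <-> B x /\ lists B s.
Proof.
rewrite /lists /=; split=> [/andP[/set_mem Bx Bs]|[Bx Bs]] //.
by rewrite Bs andbT; exact: mem_set.
Qed.

Lemma sub_lists {K : Type} {B C : set K} : B `<=` C -> lists B `<=` lists C.
Proof.
by move=> BC; elim=> // x s IH /lists_cons[/BC Cx /IH Cs]; apply/lists_cons.
Qed.

Lemma map_lists {K L : Type} {B : set K} {C : set L} {f : K -> L} :
  set_fun B C f -> set_fun (lists B) (lists C) (map f).
Proof.
move=> BC; elim=> // x s IH /lists_cons[Bx Bs].
by apply/lists_cons; split; [exact: BC | exact: IH].
Qed.

Lemma map_lists_inj {K L : Type} {B : set K} {f : K -> L} :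
  set_inj B f -> set_inj (lists B) (map f).
Proof.
move=> f_inj s t /set_mem; elim: s t => [|x s IH] [|y t] //.
move=> /lists_cons[Bx Bs] /set_mem /lists_cons[By Bt] /= [fxy st].
by rewrite (f_inj x y) ?inE // (IH t) ?inE.
Qed.

(** The set [B] is as large as the set of its finite lists; taking the list [::]
    shows that it is inhabited. *)
Definition absorbing {K : Type} (B : set K) (j : seq K -> K) : Prop :=
  set_fun (lists B) B j /\ set_inj (lists B) j.

Lemma absorbing_countable {K : Type} :
  infinite_set [set: K] -> exists (B : set K) j, absorbing B j.
Proof.
move=> Kinf; have [k _] := infinite_setN0 Kinf.
have [f [_ f_inj]] := card_le_inj k ((infiniteP _).1 Kinf).
have [g [_ gf]] := set_inj_retract (I : [set: nat] 0) f_inj.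
exists (range f), (f \o pickle \o map g).
split=> [s _|s t /set_mem fs /set_mem ft /= E].
  by exists (pickle (map g s)).
have g_inj : set_inj (range f) g.
  by move=> _ _ /set_mem[m _ <-] /set_mem[n _ <-]; rewrite !gf // => ->.
apply: (map_lists_inj g_inj); rewrite ?inE //.
by apply: (pcan_inj pickleK); apply: f_inj; rewrite ?inE.
Qed.

Record absorber (K : Type) := Absorber {
  absorbed : set K;
  absorb : seq K -> K;
  absorberP : absorbing absorbed absorb }.

Arguments absorbed {K} _ _.
Arguments absorb {K} _ _.
Arguments absorberP {K} _.
Arguments Absorber {K absorbed absorb} _.

Definition absorber_le {K : Type} (a b : absorber K) : Prop :=
  absorbed a `<=` absorbed b /\
  forall s, lists (absorbed a) s -> absorb a s = absorb b s.

(** The union of a chain absorbs its lists, because a list is finite and so lies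
    in a single member of the chain; [a0] bounds the empty chain. *)
Lemma absorber_chain {K : Type} (a0 : absorber K) (F : set (absorber K)) :
  total_on F absorber_le -> exists b, forall a, F a -> absorber_le a b.
Proof.
move=> Ftot; have [[a1 Fa1]|F0] := pselect (F !=set0); last first.
  by exists a0 => a Fa; case: F0; exists a.
pose B := \bigcup_(a in F) absorbed a.
have ex s : lists B s -> exists2 a, F a & lists (absorbed a) s.
  elim: s => [_|x s IH /lists_cons[[a Fa ax] /IH[b Fb bs]]]; first by exists a1.
  have [[ab _]|[ba _]] := Ftot a b Fa Fb.
    by exists b => //; apply/lists_cons; split=> //; exact: ab.
  by exists a => //; apply/lists_cons; split=> //; exact: (sub_lists ba).
have /choice[j jP] : forall s, exists y,
    forall a, F a -> lists (absorbed a) s -> y = absorb a s.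
  move=> s; have [[a [Fa as_]]|nex] :=
    pselect (exists a, F a /\ lists (absorbed a) s); last first.
    by exists (absorb a0 s) => a Fa as_; case: nex; exists a.
  exists (absorb a s) => b Fb bs.
  by have [[_ ab]|[_ ba]] := Ftot a b Fa Fb; [exact: ab | rewrite ba].
suff jB : absorbing B j.
  exists (Absorber jB) => a Fa; split; first by move=> x ax; exists a.
  by move=> s as_ /=; rewrite (jP s a).
split=> [s /ex[a Fa as_]|s t /set_mem/ex[a Fa as_] /set_mem/ex[b Fb bt]].
  exists a => //; rewrite /= (jP s a Fa as_); exact: (absorberP a).1.
rewrite (jP s a Fa as_) (jP t b Fb bt).
have [[ab abE]|[ba baE]] := Ftot a b Fa Fb.
  rewrite abE //; apply: (absorberP b).2; rewrite inE //.
  exact: (sub_lists ab).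
rewrite baE //; apply: (absorberP a).2; rewrite inE //.
exact: (sub_lists ba).
Qed.

(** A set [C] that exceeds an absorbing [B] by no more than the size of [B]
    embeds in [B]: lists of length 1 code the points of [B] and lists of length 2 code
    the others, which realizes [B + B] inside [seq B]. *)
Lemma absorbing_embed {K : Type} {B C : set K} {j g} :
  absorbing B j -> set_fun (C `\` B) B g -> set_inj (C `\` B) g ->
  exists u : K -> K, set_fun C B u /\ set_inj C u.
Proof.
move=> [jB j_inj] gB g_inj.
pose u x := if x \in B then j [:: x] else j [:: g x; g x].
have l1 x : B x -> lists B [:: x] by move=> Bx; apply/lists_cons.
have l2 x : C x -> ~ B x -> lists B [:: g x; g x].
  by move=> Cx nBx; do 2![apply/lists_cons; split; [exact: gB|]].
exists u; split=> [x Cx|x y /set_mem Cx /set_mem Cy]; rewrite /u.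
  case: ifPn => [/set_mem Bx|/negP]; first exact/jB/l1.
  by rewrite inE => nBx; apply/jB/l2.
have jE s t : lists B s -> lists B t -> j s = j t -> s = t.
  by move=> Bs Bt; apply: j_inj; rewrite inE.
case: ifPn => [/set_mem Bx|/negP]; last (rewrite inE => nBx);
  (case: ifPn => [/set_mem By|/negP]; last (rewrite inE => nBy)).
- by move=> /jE H; have [] := H (l1 _ Bx) (l1 _ By).
- by move=> /jE H; have := H (l1 _ Bx) (l2 _ Cy nBy).
- by move=> /jE H; have := H (l2 _ Cx nBx) (l1 _ By).
- move=> /jE H; have [E _] := H (l2 _ Cx nBx) (l2 _ Cy nBy).
  by apply: g_inj => //; rewrite inE.
Qed.

(** A maximal absorbing [B] is at least as large as its complement: otherwise
    a copy [h @` B] of [B] outside [B] has room for the new lists over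
    [B `|` h @` B], which after recoding in [B] are only as many as [B], so that
    [B] could be extended.  Hence the whole type embeds in [B], and its lists
    with it. *)
Lemma seq_retract_infinite {K : Type} :
  infinite_set [set: K] ->
  exists (i : seq K -> K) (r : K -> seq K), cancel i r.
Proof.
move=> Kinf; have [B0 [j0 j0P]] := absorbing_countable Kinf.
pose le (a b : absorber K) := `[< absorber_le a b >].
have [|r s t /asboolP[rs rsE] /asboolP[st stE]|F Ftot|] :=
    @ZL_preorder _ (Absorber j0P) le.
- by move=> a; apply/asboolP; split.
- apply/asboolP; split=> [|l rl]; first exact: subset_trans st.
  by rewrite rsE // stE //; exact: (sub_lists rs).
- have [a b Fa Fb|b bP] := absorber_chain (Absorber j0P) F.
    by have [/asboolP|/asboolP] := Ftot a b Fa Fb; [left|right].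
  by exists b => a Fa; apply/asboolP/bP.
move=> [B j jP] maxB; have [jB j_inj] := jP.
have Bb : B (j [::]) by exact: jB.
have [g [gB g_inj]] : exists g : K -> K, set_fun (~` B) B g /\ set_inj (~` B) g.
  apply: (card_le_inj (j [::])).
  have [BC|CB] := card_le_total B (~` B : set K); last first.
    by rewrite -(card_le_eql (card_setT (~` B))) -(card_le_eqr (card_setT B)).
  exfalso.
  have {}BC : B #<= ~` B.
    by rewrite -(card_le_eql (card_setT B)) -(card_le_eqr (card_setT (~` B))).
  have [h [hC h_inj]] := card_le_inj (j [::]) BC.
  pose C := B `|` h @` B.
  have hB x : B x -> C (h x) by move=> Bx; right; exists x.
  have [g [gB gh]] := set_inj_retract Bb h_inj.
  have g_inj : set_inj (C `\` B) g.
    move=> y z /set_mem[[//|[x Bx <-]] _] /set_mem[[//|[x' Bx' <-]] _].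
    by rewrite !gh // => ->.
  have [u [uB u_inj]] := absorbing_embed jP (fun y _ => gB y) g_inj.
  have jE s t : lists B s -> lists B t -> j s = j t -> s = t.
    by move=> Bs Bt; apply: j_inj; rewrite inE.
  have luB := map_lists uB.
  (* Old lists keep their place in [B]; new ones go to the copy [h @` B]. *)
  pose j' s := if s \in lists B then j s else h (j (map u s)).
  have jC : absorbing C j'.
    split=> [s Cs|s t /set_mem Cs /set_mem Ct]; rewrite /j'.
      case: ifPn => [/set_mem Bs|_]; first by left; exact: jB.
      exact/hB/jB/luB.
    case: ifPn => [/set_mem Bs|_]; case: ifPn => [/set_mem Bt|_].
    - exact: jE.
    - move=> E; case: (hC (j (map u t))); first exact/jB/luB.
      by rewrite -E; exact: jB.
    - move=> E; case: (hC (j (map u s))); first exact/jB/luB.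
      by rewrite E; exact: jB.
    - move=> /h_inj; rewrite !inE => /(_ (jB _ (luB _ Cs)) (jB _ (luB _ Ct))).
      move=> /(jE _ _ (luB _ Cs) (luB _ Ct)).
      by apply: (map_lists_inj u_inj); rewrite inE.
  have /asboolP[CB _] : le (Absorber jC) (Absorber jP).
    apply: maxB; apply/asboolP; split=> [x Bx|s Bs] /=; first by left.
    by rewrite /j' mem_set.
  by apply: (hC _ Bb); apply: CB; exact: hB.
have gB' : set_fun ([set: K] `\` B) B g by rewrite setTD.
have g_inj' : set_inj ([set: K] `\` B) g by rewrite setTD.
have [u [uB u_inj]] := absorbing_embed jP gB' g_inj'.
pose i := j \o map u.
have i_inj : injective i.
  move=> s t /= E.
  have lT (l : seq K) : lists setT l by elim: l => // x l IH; apply/lists_cons.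
  apply: (map_lists_inj u_inj); rewrite ?inE //.
  by apply: j_inj => //; rewrite inE; exact: (map_lists uB).
have [r [_ ri]] := set_inj_retract (I : [set: seq K] [::]) (in2W i_inj).
by exists i, r => s; exact: ri.
Qed.

(** * The theta-closure *)

Section Theta.
Context {X : topologicalType}.
Implicit Types (A B : set X).

Lemma sub_cl_theta A : A `<=` cl_theta A.
Proof.
by move=> x Ax U [_ Ux]; exists x; split=> //; exact: subset_closure.
Qed.

Lemma cl_theta_closed_nbhs {A} {x : X} {C : set X} :
  cl_theta A x -> closed C -> nbhs x C -> C `&` A !=set0.
Proof.
move=> Ax Cc xC; have [|y [Cy Ay]] := Ax (interior C).
  by split; [exact: open_interior | exact: xC].
exists y; split=> //; have -> : C = closure C by exact/closure_id.
exact: (closure_subset (@interior_subset _ C)).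
Qed.

(** At every point the local base is nonempty, so it can be enumerated, with
    repetitions, by the whole of [kappa X]. *)
Lemma closed_nbhs_base :
  exists v : X -> kappa X -> set X, forall x,
    (forall k, closed (v x k) /\ nbhs x (v x k)) /\
    forall W, open_nbhs x W -> exists k, v x k `<=` closure W.
Proof.
have [[_ base] _] := kappaP X.
suff /choice[v vP] : forall x : X, exists v : kappa X -> set X,
    (forall k, closed (v k) /\ nbhs x (v k)) /\
    forall W, open_nbhs x W -> exists k, v k `<=` closure W by exists v.
move=> x; have [V [VK Vx Vbase]] := base x.
have V0 : V !=set0.
  by have [|C VC _] := Vbase setT; [split; [exact: openT|] | exists C].
have [v [Vv vV]] := card_le_enum VK V0.
exists v; split=> [k|W /Vbase[C VC CW]]; first exact: Vx (Vv k).
by have [k kC] := vV C VC; exists k; rewrite kC.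
Qed.

Section Trace.
Context {K : Type} (v : X -> K -> set X).
Context (v_nbhs : forall x k, closed (v x k) /\ nbhs x (v x k)).
Context (v_base :
  forall x W, open_nbhs x W -> exists k, v x k `<=` closure W).

(** The trace [a] is indexed by lists, not by single neighbourhoods, so that one
    of its values witnesses any finite family of neighbourhoods at once; the
    points it traces need not share any neighbourhood. *)
Definition traced_by (a : seq K -> X) : set X :=
  [set x | forall s, all (fun k => a s \in v x k) s].

Lemma cl_theta_traced A x :
  cl_theta A x -> exists2 a, (forall s, A (a s)) & traced_by a x.
Proof.
move=> Ax.
suff /choice[a aP] : forall s, exists y, A y /\ all (fun k => y \in v x k) s.
  by exists a => s; have [] := aP s.
move=> s; pose C s : set X := [set y | all (fun k => y \in v x k) s].
have [C_closed C_nbhs] : closed (C s) /\ nbhs x (C s).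
  elim: s => [|k s [IHc IHn]].
    have -> : C [::] = setT by apply/seteqP.
    by split; [exact: closedT | exact: filterT].
  have -> : C (k :: s) = v x k `&` C s.
    apply/seteqP; split=> y; first by move=> /= /andP[/set_mem].
    by move=> [/mem_set yk Cy]; rewrite /C /= yk.
  have [vc vn] := v_nbhs x k.
  by split; [exact: closedI | exact: filterI].
have [y [sy Ay]] := cl_theta_closed_nbhs Ax C_closed C_nbhs.
by exists y.
Qed.

(** Choose inside each [closure (U x)] a basic neighbourhood [v x (k x)]; the
    value of [a] at the list of all the indices [k x] is common to them all. *)
Lemma finitely_non_urysohn_traced a :
  traced_by a !=set0 -> finitely_non_urysohn (traced_by a).
Proof.
move=> a0; split=> // F /finite_seqP[s ->] _ Fa U Unbhs.
have /choice[k kP] : forall x, exists k, x \in s -> v x k `<=` closure (U x).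
  (* Off [s] any index will do; one exists since [v] is a base at some point. *)
  move=> x; have [xs|xs] := boolP (x \in s).
    by have [k xk] := v_base _ _ (Unbhs x xs); exists k.
  have [x0 _] := a0; have [|k _] := v_base x0 setT; last by exists k.
  by split; [exact: openT|].
exists (a (map k s)) => x /= xs; apply: (kP x xs).
have := Fa x xs (map k s); rewrite all_map => /allP /(_ x xs) /=.
by rewrite inE.
Qed.

End Trace.

(** Read [b] as a trace through an embedding of [seq (kappa X)] in [kappa X].
    The points it traces are at most as many as the supremum, and [e b]
    enumerates them.  That [e] is chosen before [B] is what allows it to
    be iterated to reach the theta-closed hull. *)
Lemma cl_theta_cover :
  exists e : (kappa X -> X) -> card_sup (@finitely_non_urysohn X) -> X,
  forall B x, cl_theta B x ->
    exists b, (forall k, B (b k)) /\ exists m, e b m = x.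
Proof.
have [v vP] := closed_nbhs_base.
have v_nbhs x k := (vP x).1 k.
have v_base x := (vP x).2.
have [[Kinf _] _] := kappaP X.
have [k0 _] := infinite_setN0 Kinf.
have [i [r ri]] := seq_retract_infinite Kinf.
pose M (b : kappa X -> X) := traced_by v (b \o i).
have /choice[e eP] : forall b : kappa X -> X,
    exists e : card_sup (@finitely_non_urysohn X) -> X,
    forall x, M b x -> exists m, e m = x.
  move=> b; have [Mb|Mb] := pselect (M b !=set0); last first.
    by exists (fun=> b k0) => x Mx; case: Mb; exists x.
  have [e [_ eM]] := card_le_enum
    ((card_supP (@finitely_non_urysohn X)).1 _
      (finitely_non_urysohn_traced v v_base _ Mb)) Mb.
  by exists e.
exists e => B x /(cl_theta_traced v v_nbhs)[a Ba ax].
exists (a \o r); split=> [k|]; first exact: Ba.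
by apply: eP => s; rewrite /= ri; exact: ax.
Qed.
End Theta.

(** * Infinitary terms *)

(** Terms over the generators [A] for a family, indexed by [S], of operations of
    arity [K]. *)
Inductive term (A S K : Type) : Type :=
| Leaf of A
| Node of S & (K -> term A S K).
Arguments Leaf {A S K}.
Arguments Node {A S K}.

Section Term.
Context {A S K : Type} (k0 : K).

(** The second component tells a leaf from a node and gives the mark of a node.
    The first one is arbitrary at a node; the leaf at the end of the branch
    [k0, k0, ...] supplies it, so that [A] may be empty. *)
Fixpoint label (t : term A S K) (p : seq K) : A * option S :=
  match t, p with
  | Leaf a, _ => (a, None)
  | Node m f, [::] => ((label (f k0) [::]).1, Some m)
  | Node m f, k :: q => label (f k) q
  end.

Lemma label_inj : injective label.
Proof.
elim=> [a|m f IH] [b|n g] E.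
- by have := congr1 (@^~ [::]) E => /= -[->].
- by have := congr1 (@^~ [::]) E.
- by have := congr1 (@^~ [::]) E.
have := congr1 (@^~ [::]) E => /= -[_ ->]; congr Node.
apply/funext => k; apply: IH; apply/funext => q.
exact: (congr1 (@^~ (k :: q)) E).
Qed.

Fixpoint eval {X : Type} (l : A -> X) (e : (K -> X) -> S -> X)
    (t : term A S K) : X :=
  match t with
  | Leaf a => l a
  | Node m f => e (fun k => eval l e (f k)) m
  end.
End Term.

Lemma card_fun_seq {K Y : Type} :
  infinite_set [set: K] -> [set: seq K -> Y] #<= [set: K -> Y].
Proof.
move=> /seq_retract_infinite[i [r ri]].
apply: (@set_inj_card_le (seq K -> Y) (K -> Y) setT (fun f => f \o r)).
move=> f g _ _ fg.
by apply/funext => s; rewrite -[s]ri; exact: (congr1 (@^~ (i s)) fg).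
Qed.

(** * The two bounds *)

Theorem theorem5p2 (X : topologicalType) (A : set X) :
  (cl_theta A #<= [set: (kappa X -> A) * nu X]) /\
  (theta_hull A #<= [set: kappa X -> A * nu X]).
Proof.
have [e eP] := @cl_theta_cover X.
have [[Kinf _] _] := kappaP X.
have [k0 _] := infinite_setN0 Kinf.
split.
  apply: (card_le_of_cover (fun p : (kappa X -> A) * nu X =>
    if p.2 is Some m then e (set_val \o p.1) m else set_val (p.1 k0))).
  move=> x /eP[b [Ab [m <-]]].
  by exists (fun k => SigSub (mem_set (Ab k)), Some m).
(* The values of all terms form a theta-closed set containing [A]. *)
pose ev := eval (fun a : A => set_val a) e.
have hull_term : theta_hull A `<=` range ev.
  apply: smallest_sub => [|x Ax]; last by exists (Leaf (SigSub (mem_set Ax))).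
  apply/seteqP; split; first exact: sub_cl_theta.
  move=> x /eP[b [bt [m <-]]].
  have /choice[t tb] : forall k, exists t, ev t = b k.
    by move=> k; have [t _ <-] := bt k; exists t.
  by exists (Node m t) => //=; congr e; apply/funext => k; exact: tb.
apply: card_le_trans (subset_card_le hull_term) _.
apply: card_le_trans (card_image_le _ _) _.
apply: card_le_trans (card_fun_seq Kinf).
by apply: (@set_inj_card_le _ _ _ (label k0)) => s t _ _; exact: label_inj.
Qed.
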